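(* Let $p$ be an odd prime, $G=\mu_p$, $x\in G$ a generator and $\alpha$ an integer whose class generates $(\mathbb{Z}/p\mathbb{Z})^\times$. For each divisor $u$ of $p-1$, put $r+1=(p-1)/u$ (the multiplicative order of $\beta:=\alpha^u$ modulo $p$), $I=\{1\}$ and $$A_i=\{x^{\alpha^i},x^{\alpha^i\beta},\dots,x^{\alpha^i\beta^r}\},\qquad i=0,\dots,u-1.$$ Then $\mathcal{P}=\{I,A_0,\dots,A_{u-1}\}$ is a unital partition of $G$, and every unital partition of $G$ arises in this way for some $u\mid p-1$. Moreover, every unital partition of $\mu_p$ is a fusion partition.
   Context: A unital partition of a finite commutative group $G$ is a partition $G=I\sqcup A_0\sqcup\dots\sqcup A_s$ with $I=\{1\}$ such that, with $a_i=\sum_{x\in A_i}x\in\mathbb{Z}[G]$, the $\mathbb{Z}$-span of $1$ and the $a_i$ is closed under multiplication in $\mathbb{Z}[G]$. It is a fusion partition if in addition: (1) for every member $A_i$ there is a member $A_{i^*}$ with $A_{i^*}=\{x^{-1}\mid x\in A_i\}$; and (2) writing $a_ia_j=\sum_k n^k_{i,j}a_k$ (sum over all members of the partition, including $I$), one has $n^k_{i,j}|A_k|=n^{j^*}_{i,k^*}|A_{j^*}|$ for all $i,j,k$. *)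

(* Defs.v *)
From HB Require Import structures.
From mathcomp Require Import all_boot all_order all_algebra all_fingroup.
Set Implicit Arguments. Unset Strict Implicit. Unset Printing Implicit Defensive.
Import GRing.Theory Num.Theory.

Local Open Scope group_scope.

(* Elements of the group ring Z[G] are represented as functions gT -> int
   (supported on G). *)
Definition gind (gT : finGroupType) (A : {set gT}) : gT -> int :=
  fun z => Posz (z \in A).

Definition gconv (gT : finGroupType) (G : {set gT}) (f g : gT -> int) : gT -> int :=
  fun z => (\sum_(y in G) f y * g ((y^-1 * z)%g))%R.

(* A unital partition of G: P is a partition of G into nonempty blocks,
   {1} is a block, and the Z-span of the block sums is closed under
   multiplication (the span contains 1 = sum of the block {1}). *)
Definition unital_partition (gT : finGroupType) (G : {set gT})
    (P : {set {set gT}}) : Prop :=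
  [/\ partition P G, [set 1] \in P &
      forall A B, A \in P -> B \in P ->
        exists c : {set gT} -> int, forall z,
          gconv G (gind A) (gind B) z = (\sum_(C in P) c C * gind C z)%R].

Definition setinv (gT : finGroupType) (A : {set gT}) : {set gT} :=
  [set a^-1 | a in A].

(* structure constant n^C_{A,B}: coefficient of c = sum of C in a*b,
   i.e. the value of a*b at any (here: the chosen representative) element of C. *)
Definition sconst (gT : finGroupType) (G : {set gT}) (A B C : {set gT}) : int :=
  gconv G (gind A) (gind B) (repr C).

Definition fusion_partition (gT : finGroupType) (G : {set gT})
    (P : {set {set gT}}) : Prop :=
  [/\ unital_partition G P,
      forall A, A \in P -> setinv A \in P &
      forall A B C, A \in P -> B \in P -> C \in P ->
        (sconst G A B C * Posz #|C| =
         sconst G A (setinv C) (setinv B) * Posz #|setinv B|)%R].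

(* A_i = { x^(alpha^i beta^j) : j = 0..r }, beta = alpha^u, r+1 = (p-1)/u;
   exponents are integers, reduced mod p (x has order p). *)
Definition cyc_block (gT : finGroupType) (p : nat) (x : gT) (alpha : int)
    (u i : nat) : {set gT} :=
  [set x ^+ `|((alpha ^+ i * (alpha ^+ u) ^+ j) %% p)%Z|%N | j : 'I_(p.-1 %/ u)].

Definition cyc_partition (gT : finGroupType) (p : nat) (x : gT) (alpha : int)
    (u : nat) : {set {set gT}} :=
  [set [set 1]] :|: [set cyc_block p x alpha u i | i : 'I_u].

(* Main.v *)
(** Schur's theorem on multipliers: if q is a prime not dividing #|G|, then
modulo q the q-th power of the sum of a block A is the sum of the a ^+ q for
a in A (Frobenius), and its coefficients are constant on blocks; hence so is
membership in A of q-th roots. It follows that, for every m coprime to #|G|,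
y |-> y ^+ m permutes the blocks of a unital partition of the abelian group G.
With m = -1 this gives the fusion property. When #|G| = p these maps act
transitively on G \ {1}, so the blocks other than {1} are the orbits of a
subgroup of the cyclic group (Z/p)^*, which is generated by a power of alpha.
Conversely these orbits span a ring since the group acts by automorphisms. *)

Require Import Defs.
From HB Require Import structures.
From mathcomp Require Import all_boot all_order all_algebra all_fingroup all_solvable finfield mxrepresentation.
Set Implicit Arguments. Unset Strict Implicit. Unset Printing Implicit Defensive.
Import GRing.Theory.
Local Open Scope group_scope.

(** * The span of the block sums as block-constant functions *)

Lemma sum_gind (gT : finGroupType) (G : {set gT}) (P : {set {set gT}})
    (c : {set gT} -> int) (z : gT) : partition P G ->
  (\sum_(C in P) c C * gind C z = if z \in G then c (pblock P z) else 0)%R.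
Proof.
move=> partP; have [/eqP covP tiP _] := and3P partP.
case: ifPn => Gz; last first.
  rewrite big1 // => C PC; rewrite /gind; case: (boolP (z \in C)); last by rewrite mulr0.
  by move=> Cz; rewrite (subsetP (partitionS partP PC) z Cz) in Gz.
have Bz: z \in pblock P z by rewrite mem_pblock covP.
have PB : pblock P z \in P by rewrite pblock_mem ?covP.
rewrite (bigD1 (pblock P z)) /=; last exact: PB.
rewrite {1}/gind Bz mulr1.
rewrite big1 ?addr0 // => C /andP[PC neC]; rewrite /gind.
case: (boolP (z \in C)) => [Cz | ]; last by rewrite mulr0.
by rewrite (def_pblock tiP PC Cz) eqxx in neC.
Qed.

(** On [G] these are the functions in the span of the block sums, described without coefficients. *)
Definition block_constant (gT : finGroupType) (G : {set gT})
    (P : {set {set gT}}) (f : gT -> int) :=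
  {in G &, forall y z, pblock P y = pblock P z -> f y = f z}.

Lemma unital_gconv_gind (gT : finGroupType) (G : {set gT}) (P : {set {set gT}})
    (A B : {set gT}) : unital_partition G P -> A \in P -> B \in P ->
  block_constant G P (gconv G (gind A) (gind B)).
Proof.
case=> partP _ mulP PA PB y z Gy Gz eqyz.
by have [c cE] := mulP A B PA PB; rewrite !cE !(sum_gind _ _ partP) Gy Gz eqyz.
Qed.

(** On [G], [f] is the combination of the block sums with coefficients [f (repr C)], so linearity
    reduces to products of two blocks. This allows powers of a block sum to be formed by
    iteration. *)
Lemma unital_gconv (gT : finGroupType) (G : {group gT}) (P : {set {set gT}})
    (A : {set gT}) (f : gT -> int) : unital_partition G P -> A \in P ->
  block_constant G P f -> block_constant G P (gconv G (gind A) f).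
Proof.
move=> unP PA fP; have [partP _ _] := unP; have covP := cover_partition partP.
pose c (C : {set gT}) := f (repr C).
have gconvE z : z \in G ->
    gconv G (gind A) f z = (\sum_(C in P) c C * gconv G (gind A) (gind C) z)%R.
  move=> Gz; under [RHS]eq_bigr => C _ do rewrite mulr_sumr.
  rewrite exchange_big; apply: eq_bigr => y Gy /=.
  under eq_bigr => C _ do rewrite mulrCA.
  have Gyz: y^-1 * z \in G by rewrite groupM ?groupV.
  rewrite -mulr_sumr (sum_gind _ _ partP) Gyz; congr (_ * _)%R.
  have Bw : y^-1 * z \in pblock P (y^-1 * z) by rewrite mem_pblock covP.
  have rw := mem_repr _ Bw.
  have tiP := partition_trivIset partP.
  apply: fP => //; last by rewrite (same_pblock tiP rw).
  by rewrite -covP -mem_pblock (same_pblock tiP rw).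
move=> y z Gy Gz eqyz; rewrite !gconvE //; apply: eq_bigr => C PC.
by rewrite (unital_gconv_gind unP PA PC Gy Gz eqyz).
Qed.

(** * Schur's theorem on multipliers *)

(** The matrices [rG y] commute, and in characteristic [q] the Frobenius map is additive on
    commuting elements. An iterated product expresses the power so that size 0, where 1 = 0, is
    covered too. *)
Lemma mx_Frobenius_sum (gT : finGroupType) (G : {group gT}) (q n : nat)
    (rG : mx_representation 'F_q G n) (A : {set gT}) :
  prime q -> abelian G -> A \subset G ->
  (iter q (mulmx (\sum_(y in A) rG y)) 1%:M = \sum_(y in A) rG (y ^+ q)%g)%R.
Proof.
move=> q_pr abG sAG; case: n rG => [|n] rG; first by rewrite [LHS]thinmx0 [RHS]thinmx0.
have qM : (q \in [pchar 'M['F_q]_n.+1])%R by rewrite pchar_lalg pchar_Fp.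
set a := (\sum_(y in A) _)%R.
have -> k : (iter k (mulmx a) 1%:M = a ^+ k)%R.
  by elim: k => //= k ->; rewrite exprS.
rewrite -(pFrobenius_autE qM) /a -!big_enum /=.
have: {subset enum A <= G} by move=> y; rewrite mem_enum => /(subsetP sAG).
elim: (enum A) => [_|y s IHs sG].
  by rewrite !big_nil pFrobenius_aut0.
have Gy: y \in G by apply: sG; rewrite mem_head.
have {}sG: {subset s <= G} by move=> z sz; apply: sG; rewrite inE sz orbT.
rewrite !big_cons pFrobenius_autD_comm; last first.
  rewrite /GRing.comm big_seq mulr_sumr mulr_suml; apply: eq_bigr => z /sG Gz.
  by rewrite -!mulmxE -!repr_mxM // (centsP abG).
by rewrite IHs // pFrobenius_autE repr_mxX.
Qed.

(* The convolution powers of the sum of A are constant on blocks, and modulo q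
   the q-th one counts the q-th roots lying in A (Frobenius). *)
Lemma pblock_expg_prime (gT : finGroupType) (G : {group gT})
    (P : {set {set gT}}) (q : nat) :
  abelian G -> unital_partition G P -> prime q -> coprime #|G| q ->
  {in G &, forall y z, pblock P (y ^+ q) = pblock P (z ^+ q) ->
                       pblock P y = pblock P z}.
Proof.
move=> abG unP q_pr coGq y z Gy Gz eqyz; have [partP P1 _] := unP.
have [covP tiP] := (cover_partition partP, partition_trivIset partP).
set A := pblock P y; have PA : A \in P by rewrite pblock_mem ?covP.
have sAG : A \subset G := partitionS partP PA.
(* The regular representation models the group ring modulo [q]: [E f] is the image of [f], and [E]
   turns convolution into the matrix product. *)
pose aG := regular_repr 'F_q G.
pose E (f : gT -> int) := (\sum_(w in G) (f w)%:~R *: aG w)%R.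
have E_gind (B : {set gT}) : B \subset G -> E (gind B) = (\sum_(w in B) aG w)%R.
  move=> sBG; rewrite /E (big_setID B) /= (setIidPr sBG).
  rewrite [X in (_ + X)%R]big1 ?addr0 => [|w /setDP[_ /negPf Bw]].
    by apply: eq_bigr => w Bw; rewrite /gind Bw scale1r.
  by rewrite /gind Bw scale0r.
have E_gconv f g : (E (gconv G f g) = E f *m E g)%R.
  rewrite /E mulmx_suml.
  under [RHS]eq_bigr => u Gu.
    rewrite mulmx_sumr (reindex_inj (mulgI u^-1)) /=.
    rewrite (eq_bigl (mem G)) => [|w]; last by rewrite /= groupMl ?groupV.
    under eq_bigr => w Gw.
      rewrite -scalemxAl -scalemxAr -repr_mxM ?groupM ?groupV // mulKVg scalerA.
      over.
    over.
  rewrite exchange_big /=; apply: eq_bigr => w Gw.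
  rewrite /gconv rmorph_sum scaler_suml; apply: eq_bigr => u Gu.
  by rewrite rmorphM.
pose f k := iter k (gconv G (gind A)) (gind [set 1]).
have fP k : block_constant G P (f k).
  elim: k => [|k IHk]; last exact: unital_gconv.
  move=> u v Gu Gv; rewrite /f /= /gind => /eqP.
  have Eb w : w \in G -> (w \in [set 1]) = (pblock P w == [set 1]).
    move=> Gw; apply/idP/eqP => [w1|<-]; last by rewrite mem_pblock covP.
    exact: def_pblock.
  by rewrite !Eb // => /eqP->.
have Ef k : (E (f k) = iter k (mulmx (\sum_(w in A) aG w)) 1%:M)%R.
  elim: k => [|k IHk] /=; last by rewrite E_gconv IHk E_gind.
  by rewrite E_gind ?sub1G // big_set1 repr_mx1.
(* [gring_proj w] reads off the coefficient of [w]. *)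
have projE w : w \in G -> gring_proj w (E (f q)) = ((f q w)%:~R *: 1%:M)%R.
  move=> Gw; rewrite linear_sum (bigD1 w) //= big1 ?addr0 => [|u /andP[Gu neu]].
    by rewrite linearZ /= gring_projE // eqxx.
  by rewrite linearZ /= gring_projE // eq_sym (negPf neu) scaler0.
have fq w : w \in G -> ((f q (w ^+ q)%g)%:~R = (w \in A)%:R :> 'F_q)%R.
  move=> Gw; have Gwq : w ^+ q \in G by rewrite groupX.
  have := projE _ Gwq; rewrite Ef mx_Frobenius_sum // linear_sum.
  (* As [q] is coprime to the order, the [q]-th power map is injective on [G]: only the term [i = w]
     can contribute to the coefficient of [w ^+ q]. *)
  have expI := can_in_inj (expgK coGq).
  have -> : (\sum_(i in A) gring_proj (w ^+ q)%g (aG (i ^+ q)%g)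
      = (w \in A)%:R *: 1%:M :> 'M['F_q]_1)%R.
    transitivity (\sum_(i in A | i == w) (1%:M : 'M['F_q]_1))%R.
      rewrite big_mkcondr; apply: eq_bigr => i /(subsetP sAG) Gi.
      rewrite gring_projE ?groupX // (inj_in_eq expI) // eq_sym.
      by case: eqP.
    have [Aw | /negPf Aw] := boolP (w \in A).
      rewrite (big_pred1 w) ?scale1r // => i /=.
      by case: eqP => [->|_]; rewrite ?Aw ?andbF.
    by rewrite big_pred0 ?scale0r // => i; case: eqP => [->|_]; rewrite ?Aw ?andbF.
  by move/(congr1 (fun M : 'M_1 => M 0%R 0%R)); rewrite !mxE eqxx !mulr1 => <-.
(* Block constancy equates the indicators of [y \in A] and [z \in A] in ['F_q]. The first is 1, so
   the second is not 0. *)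
have := fP q _ _ (groupX q Gy) (groupX q Gz) eqyz.
move/(congr1 (fun m : int => m%:~R : 'F_q)%R); rewrite !fq // mem_pblock covP Gy.
rewrite /A; have [zA _ | _ /eqP] := boolP (z \in pblock P y).
  by rewrite (same_pblock tiP zA).
by rewrite oner_eq0.
Qed.

(** One direction follows by splitting off prime factors of the exponent. The other is the same
    direction for an exponent inverse to [m] modulo the order of [G]. *)
Lemma eq_pblock_expg (gT : finGroupType) (G : {group gT})
    (P : {set {set gT}}) (m : nat) :
  abelian G -> unital_partition G P -> coprime #|G| m ->
  {in G &, forall y z, (pblock P (y ^+ m) == pblock P (z ^+ m)) =
                       (pblock P y == pblock P z)}.
Proof.
move=> abG unP.
have descend k : coprime #|G| k ->
    {in G &, forall y z, pblock P (y ^+ k) = pblock P (z ^+ k) ->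
                         pblock P y = pblock P z}.
  elim/ltn_ind: k => -[|[|k]] IHk coGk y z Gy Gz.
  (* Exponent 0 is coprime to the order only when [G] is trivial. *)
  - have G1 : G :=: 1.
      by apply: card_le1_trivg; move: coGk; rewrite /coprime gcdn0 => /eqP->.
    by move: Gy Gz; rewrite G1 => /set1P-> /set1P->.
  - by [].
  have q_pr : prime (pdiv k.+2) by apply: pdiv_prime.
  have /dvdnP[d kE] := pdiv_dvd k.+2.
  have d_lt : d < k.+2.
    by rewrite [ltnRHS]kE ltn_Pmulr ?prime_gt1 //; case: d kE => // /eqP.
  move: coGk; rewrite [k.+2]kE coprimeMr => /andP[coGd coGq].
  move=> eqk; apply: (IHk d) => //.
  by apply: (pblock_expg_prime abG unP q_pr coGq); rewrite ?groupX // -!expgM.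
move=> coGm y z Gy Gz; apply/eqP/eqP; first exact: descend.
(* By Euler's theorem this power of [m] is its inverse modulo the order of [G]. *)
have expK w : w \in G -> (w ^+ m) ^+ (m ^ (totient #|G|).-1) = w.
  move=> Gw; rewrite -expgM -expnS prednK ?totient_gt0 ?cardG_gt0 //.
  have com : coprime m #|G| by rewrite coprime_sym.
  apply/eqP; rewrite -[X in _ == X]expg1 eq_expg_mod_order.
  by rewrite -(modn_dvdm _ (order_dvdG Gw)) Euler_exp_totient // modn_dvdm ?order_dvdG.
move=> eqyz; have coGk : coprime #|G| (m ^ (totient #|G|).-1) by rewrite coprimeXr.
by apply: (descend _ coGk); rewrite ?groupX ?expK.
Qed.

(** * Inverse blocks and the fusion property *)

Lemma setinvE (gT : finGroupType) (A : {set gT}) : setinv A = A^-1.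
Proof.
apply/setP=> y; rewrite inE; apply/imsetP/idP => [[z Az ->] | Ay].
  by rewrite invgK.
by exists y^-1; rewrite ?invgK.
Qed.

Lemma in_pblockE (gT : finGroupType) (G : {set gT}) (P : {set {set gT}})
    (y z : gT) : partition P G -> y \in G -> z \in G ->
  (z \in pblock P y) = (pblock P z == pblock P y).
Proof.
move=> partP Gy Gz; have [/eqP covP tiP _] := and3P partP.
by rewrite eq_sym eq_pblock // covP.
Qed.

Lemma partition_repr (gT : finGroupType) (G : {set gT}) (P : {set {set gT}})
    (A : {set gT}) : partition P G -> A \in P ->
  exists y, [/\ y \in G, y \in A & A = pblock P y].
Proof.
move=> partP PA; have /set0Pn[y Ay] := partition_neq0 partP PA.
exists y; split=> //; first exact: (subsetP (partitionS partP PA)).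
by rewrite (def_pblock (partition_trivIset partP) PA Ay).
Qed.

(** On [G], inversion is the power map of exponent [#|G|.-1], which is coprime to [#|G|]. *)
Lemma unital_setinv (gT : finGroupType) (G : {group gT}) (P : {set {set gT}})
    (A : {set gT}) : abelian G -> unital_partition G P -> A \in P ->
  setinv A \in P.
Proof.
move=> abG unP PA; have [partP _ _] := unP.
have [y [Gy Ay ->]] := partition_repr partP PA.
have invgE w : w \in G -> w^-1 = w ^+ #|G|.-1.
  move=> Gw; apply: (mulgI w); rewrite mulgV -expgS prednK ?cardG_gt0 //.
  by rewrite expg_cardG.
have PGy : pblock P y^-1 \in P by rewrite pblock_mem ?(cover_partition partP) ?groupV.
suff -> : setinv (pblock P y) = pblock P y^-1 by [].
apply/setP=> w; rewrite setinvE inE.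
have [Gw | nGw] := boolP (w \in G); last first.
  have nG B : B \in P -> (w \in B) = false.
    by move=> PB; apply: contraNF nGw; apply: (subsetP (partitionS partP PB)).
  rewrite nG //; apply: contraNF nGw => /(subsetP (partitionS partP _)).
  by rewrite groupV; apply; rewrite pblock_mem ?(cover_partition partP).
rewrite !(in_pblockE partP) ?groupV // (invgE w) // -{1}[y]invgK (invgE y^-1) ?groupV //.
by rewrite (eq_pblock_expg abG unP) ?groupV // coprimenP ?cardG_gt0.
Qed.

(** The convolution is constant on [C], so the chosen representative can be traded for a sum over
    all of [C], which is a count of triples. *)
Lemma sconst_card (gT : finGroupType) (G : {group gT}) (P : {set {set gT}})
    (A B C : {set gT}) : unital_partition G P -> A \in P -> B \in P -> C \in P ->
  (sconst G A B C * Posz #|C| = \sum_(z in C) gconv G (gind A) (gind B) z)%R.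
Proof.
move=> unP PA PB PC; have [partP _ _] := unP.
have [y [Gy Cy CE]] := partition_repr partP PC.
have sCG := subsetP (partitionS partP PC).
rewrite -natz mulr_natr -sumr_const; apply: eq_bigr => z Cz.
have Cr : repr C \in C by apply: mem_repr Cy.
apply: (unital_gconv_gind unP PA PB); try exact: sCG.
have tiP := partition_trivIset partP.
by rewrite !(def_pblock tiP PC).
Qed.

(* Both sides count the triples (a, b, c) in A x B x C with a b = c. *)
Lemma unital_fusion (gT : finGroupType) (G : {group gT}) (P : {set {set gT}}) :
  abelian G -> unital_partition G P -> fusion_partition G P.
Proof.
move=> abG unP; have [partP _ _] := unP.
have invP A : A \in P -> setinv A \in P := unital_setinv abG unP.
split=> // A B C PA PB PC; rewrite !(sconst_card unP) ?invP // !setinvE.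
rewrite exchange_big [RHS]exchange_big; apply: eq_bigr => y Gy /=.
rewrite -!mulr_sumr; congr (_ * _)%R.
transitivity (\sum_(z | (z \in C) && (y^-1 * z \in B)%g) 1 : int)%R.
  by rewrite big_mkcondr; apply: eq_bigr => z _; rewrite /gind; case: (_ \in B).
(* With [a = y] fixed, put [c = w^-1 * y]. By commutativity [b = w^-1], so [w] runs over the inverse
   of [B] with [y^-1 * w] in the inverse of [C]. *)
rewrite (reindex_inj (inj_comp (mulIg y) invg_inj)) /=.
transitivity (\sum_(z | (z \in B^-1%g) && (y^-1 * z \in C^-1)%g) 1 : int)%R; last first.
  by rewrite big_mkcondr; apply: eq_bigr => z _; rewrite /gind; case: (_ \in C^-1)%g.
apply: eq_bigl => w; rewrite !inE invMg invgK andbC.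
have [Cw | _] := boolP (w^-1 * y \in C); last by rewrite !andbF.
have Gw : w^-1 \in G.
  by rewrite -(groupMr _ Gy); apply: (subsetP (partitionS partP PC)).
by rewrite (centsP abG _ Gw _ Gy) mulKg.
Qed.

(** * Criteria for a partition to be unital *)

Lemma block_constant_unital (gT : finGroupType) (G : {group gT})
    (P : {set {set gT}}) : partition P G -> [set 1] \in P ->
  (forall A B, A \in P -> B \in P ->
     block_constant G P (gconv G (gind A) (gind B))) ->
  unital_partition G P.
Proof.
move=> partP P1 gconvP; split=> // A B PA PB.
exists (fun C => gconv G (gind A) (gind B) (repr C)) => z.
rewrite (sum_gind _ _ partP); case: ifPn => [Gz | nGz].
  have Bz : z \in pblock P z by rewrite mem_pblock (cover_partition partP).
  have PBz : pblock P z \in P by rewrite pblock_mem ?(cover_partition partP).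
  have rz := mem_repr _ Bz.
  apply: gconvP => //; first exact: subsetP (partitionS partP PBz) _ rz.
  by rewrite (same_pblock (partition_trivIset partP) rz).
rewrite /gconv big1 // => y Gy; rewrite /gind.
case: (boolP (_ \in B)) => [/(subsetP (partitionS partP PB)) | _].
  by rewrite groupMl ?groupV // (negPf nGz).
by rewrite mulr0.
Qed.

(** The [w]-th power map is an automorphism of [G] preserving [A] and [B]; reindexing the
    convolution along it, with inverse [expg_invn], gives the invariance. *)
Lemma gconv_gind_expg (gT : finGroupType) (G : {group gT}) (A B : {set gT})
    (w : nat) : abelian G -> coprime #|G| w ->
  {in G, forall y, (y ^+ w \in A) = (y \in A)} ->
  {in G, forall y, (y ^+ w \in B) = (y \in B)} ->
  {in G, forall y, gconv G (gind A) (gind B) (y ^+ w) =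
                   gconv G (gind A) (gind B) y}.
Proof.
move=> abG coGw Aw Bw y Gy; rewrite /gconv.
have expK := expgK coGw.
rewrite (reindex_onto (fun v => v ^+ w) (fun v => v ^+ expg_invn G w)) /=; last first.
  by move=> v Gv; rewrite expgAC expK.
apply: eq_big => [v | v].
  apply/andP/idP => [[Gvw /eqP <-] | Gv]; first exact: groupX.
  by rewrite groupX // expK.
case/andP=> Gvw /eqP vE; have Gv : v \in G by rewrite -vE groupX.
rewrite /gind Aw //; congr (_ * Posz _)%R.
rewrite -(Bw (v^-1 * y)) ?groupM ?groupV // expgMn ?expgVn //.
by apply: (centsP abG); rewrite ?groupV.
Qed.

(** * Discrete logarithms in a group of prime order *)

Section PrimeOrder.

Variables (gT : finGroupType) (p : nat) (x : gT) (alpha : int).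
Hypotheses (p_pr : prime p) (ox : #[x] = p).
Hypothesis prim_alpha : (p.-1.-primitive_root (alpha%:~R : 'F_p))%R.

Let zeta : 'F_p := (alpha%:~R)%R.
(** The non-identity element with discrete logarithm [k], which matters only modulo [p.-1]. Raising
    to the power [zeta ^+ l] adds [l] to the logarithm. *)
Let zexp (k : nat) : gT := x ^+ (zeta ^+ k)%R.

Let p1_gt0 : 0 < p.-1. Proof. by rewrite -subn1 subn_gt0 prime_gt1. Qed.

Lemma expg_Fp_nat (m : nat) : x ^+ (m%:R : 'F_p)%R = x ^+ m.
Proof. by rewrite val_Fp_nat // -ox expg_mod_order. Qed.

Lemma expg_Fp_inj : injective (fun v : 'F_p => x ^+ v).
Proof.
move=> v w /eqP; rewrite eq_expg_mod_order ox => /eqP eqvw.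
by rewrite -[v]natr_Zp -[w]natr_Zp -(Fp_nat_mod p_pr v) eqvw Fp_nat_mod.
Qed.

Lemma expg_FpM (v w : 'F_p) : x ^+ v ^+ w = x ^+ (v * w)%R.
Proof. by rewrite -expgM -[LHS]expg_Fp_nat natrM !natr_Zp. Qed.

Lemma expg_mod_intr (z : int) : x ^+ `|(z %% p)%Z|%N = x ^+ (z%:~R : 'F_p)%R.
Proof.
rewrite -[LHS]expg_Fp_nat; congr (x ^+ nat_of_ord _).
have p_neq0 : (p%:Z != 0)%R by rewrite eqz_nat -lt0n prime_gt0.
rewrite pmulrn gez0_abs ?modz_ge0 // [in RHS](divz_eq z p).
by rewrite [RHS]intrD intrM -[X in (_ * X)%R]pmulrn pchar_Fp_0 // mulr0 add0r.
Qed.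

Lemma zexpD (k l : nat) : zexp (k + l) = zexp k ^+ (zeta ^+ l)%R.
Proof. by rewrite /zexp expg_FpM exprD. Qed.

Lemma eq_zexp (k l : nat) : (zexp k == zexp l) = (k == l %[mod p.-1]).
Proof. by rewrite (inj_eq expg_Fp_inj) (eq_prim_root_expr prim_alpha). Qed.

Lemma zeta_neq0 (k : nat) : (zeta ^+ k != 0)%R.
Proof.
apply: expf_neq0; apply/eqP=> z0; have := prim_expr_order prim_alpha.
by rewrite -/zeta z0 expr0n gtn_eqF // => /esym/eqP; rewrite oner_eq0.
Qed.

Lemma coprime_zeta (k : nat) : coprime #|<[x]>| (zeta ^+ k)%R.
Proof.
by rewrite -orderE ox -unitFpE // natr_Zp unitfE zeta_neq0.
Qed.

Lemma zexp_neq1 (k : nat) : zexp k != 1.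
Proof.
by rewrite -(expg0 x) -(expg_Fp_nat 0) (inj_eq expg_Fp_inj) zeta_neq0.
Qed.

Lemma mem_zexp (k : nat) : zexp k \in <[x]>. Proof. exact: mem_cycle. Qed.

(** By Fermat a nonzero exponent is a root of unity of order dividing [p.-1], hence a power of
    [zeta]. *)
Lemma cycleP_zexp (y : gT) : y \in <[x]> -> y = 1 \/ exists k, y = zexp k.
Proof.
case/cycleP=> m ->; rewrite -expg_Fp_nat.
have [-> | nzm] := eqVneq (m%:R : 'F_p)%R 0%R; first by left.
right; have [k ->] : {k : 'I_p.-1 | (m%:R = zeta ^+ k)%R}.
  apply: (prim_rootP prim_alpha); apply: (mulfI nzm).
  rewrite -exprS prednK ?prime_gt0 // mulr1.
  by have := expf_card (m%:R : 'F_p)%R; rewrite card_Fp.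
by exists k.
Qed.

(** * The cyclotomic partition attached to a divisor of [p.-1] *)

Section Block.

Variable u : nat.
Hypothesis dv_u : u %| p.-1.

Let u_gt0 : 0 < u. Proof. exact: dvdn_gt0 dv_u. Qed.

(** In discrete logarithms the block is the residue class of [i] modulo [u], since multiplying by
    beta adds [u]. *)
Lemma cyc_blockP (i : nat) (y : gT) :
  reflect (exists2 k, y = zexp k & k = i %[mod u]) (y \in cyc_block p x alpha u i).
Proof.
have blockE j : x ^+ `|((alpha ^+ i * (alpha ^+ u) ^+ j)%R %% p)%Z|%N = zexp (i + u * j).
  by rewrite expg_mod_intr rmorphM !rmorphXn -exprM -exprD.
apply: (iffP imsetP) => [[j _ ->] | [k -> eqki]].
  by exists (i + u * j); rewrite ?blockE // mulnC addnC modnMDl.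
(* Adding a multiple of [p.-1] leaves [zexp k] unchanged and keeps the natural subtraction of [i]
   from truncating. *)
have le_ik : i <= k + p.-1 * i by rewrite (leq_trans _ (leq_addl _ _)) // leq_pmull.
have /dvdnP[t tE] : u %| k + p.-1 * i - i.
  rewrite -eqn_mod_dvd // -modnDmr -modnMml.
  by have /eqP-> := dv_u; rewrite mul0n mod0n addn0 eqki.
have N_gt0 : 0 < p.-1 %/ u by rewrite divn_gt0 // dvdn_leq.
exists (Ordinal (ltn_pmod t N_gt0)) => //=; rewrite blockE.
apply/eqP; rewrite eq_zexp muln_modr [(u * (_ %/ u))%N]mulnC (divnK dv_u) modnDmr.
by rewrite [(u * t)%N]mulnC -tE subnKC // mulnC addnC modnMDl.
Qed.

Lemma mem_cyc_block (i k : nat) :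
  (zexp k \in cyc_block p x alpha u i) = (k == i %[mod u]).
Proof.
apply/cyc_blockP/eqP => [[l /eqP] | eqki]; last by exists k.
rewrite eq_zexp => /eqP eqkl <-.
by rewrite -(modn_dvdm k dv_u) eqkl modn_dvdm.
Qed.

Lemma cyc_partition_expg (B : {set gT}) (s : nat) (y : gT) :
  B \in cyc_partition p x alpha u -> u %| s -> y \in <[x]> ->
  (y ^+ (zeta ^+ s)%R \in B) = (y \in B).
Proof.
move=> PB dv_s; have /eqP s0 := dv_s.
case/cycleP_zexp=> [-> | [k ->]]; first by rewrite expg1n.
rewrite -zexpD; case/setUP: PB => [/set1P-> | /imsetP[i _ ->]].
  by rewrite !inE !(negPf (zexp_neq1 _)).
by rewrite !mem_cyc_block -modnDmr s0 addn0.
Qed.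

Lemma cyc_partition_partition : partition (cyc_partition p x alpha u) <[x]>.
Proof.
have one_block i : 1 \notin cyc_block p x alpha u i.
  by apply/cyc_blockP=> -[k /esym/eqP]; rewrite (negPf (zexp_neq1 k)).
apply/and3P; split.
- apply/eqP/setP=> y; apply/bigcupP/idP => [[B] | /cycleP_zexp [-> | [k ->]]].
  + case/setUP=> [/set1P-> /set1P-> | /imsetP[i _ ->]]; first exact: group1.
    by case/cyc_blockP=> k -> _; apply: mem_zexp.
  + by exists [set 1]; rewrite ?set11 // !inE eqxx.
  exists (cyc_block p x alpha u (Ordinal (ltn_pmod k u_gt0))).
    by rewrite inE imset_f ?orbT.
  by rewrite mem_cyc_block /= modn_mod.
- apply/trivIsetP=> A B PA PB neAB; rewrite -setI_eq0; apply: contraNT neAB.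
  case/set0Pn=> y /setIP[].
  case/setUP: PA => [/set1P-> | /imsetP[i _ ->]];
    case/setUP: PB => [/set1P-> | /imsetP[j _ ->]] //.
  + by move=> /set1P->; rewrite (negPf (one_block j)).
  + by move=> By /set1P y1; rewrite y1 (negPf (one_block i)) in By.
  case/cyc_blockP=> k -> eqki; rewrite mem_cyc_block eqki !modn_small //.
  by move/eqP/val_inj->.
apply/negP=> /setUP[/set1P/setP/(_ 1) | /imsetP[i _ /setP/(_ (zexp i))]].
  by rewrite !inE eqxx.
by rewrite mem_cyc_block eqxx inE.
Qed.

(** Non-identity members of one block differ by a power map with exponent [zeta ^+ s], [u %| s].
    Such a map preserves every block, hence every convolution of two blocks. *)
Lemma cyc_partition_unital : unital_partition <[x]> (cyc_partition p x alpha u).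
Proof.
have partP := cyc_partition_partition.
have [covP tiP] := (cover_partition partP, partition_trivIset partP).
have P1 : [set 1] \in cyc_partition p x alpha u by rewrite !inE eqxx.
apply: block_constant_unital => // A B PA PB y z Gy Gz /eqP.
rewrite eq_sym -(in_pblockE partP) //.
case: (cycleP_zexp Gy) => [-> | [k yE]].
  by rewrite (def_pblock tiP P1 (set11 1)) => /set1P->.
have PBi : cyc_block p x alpha u (Ordinal (ltn_pmod k u_gt0))
             \in cyc_partition p x alpha u by rewrite inE imset_f ?orbT.
rewrite (def_pblock tiP PBi) /= ?yE ?mem_cyc_block ?modn_mod //.
case/cyc_blockP=> l -> eqlk.
(* This is [l - k] modulo [p.-1], shifted to avoid truncation. *)
pose s := l + p.-1 * k - k.
have le_kl : k <= l + p.-1 * k by rewrite (leq_trans _ (leq_addl _ _)) // leq_pmull.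
have dv_s : u %| s.
  rewrite -eqn_mod_dvd // -modnDmr -modnMml.
  by have /eqP-> := dv_u; rewrite mul0n mod0n addn0 eqlk modn_mod.
have -> : zexp l = zexp k ^+ (zeta ^+ s)%R.
  by apply/eqP; rewrite -zexpD eq_zexp subnKC // mulnC addnC modnMDl.
apply/esym/(gconv_gind_expg (cycle_abelian x) (coprime_zeta s)) => [w Gw|w Gw|].
- exact: cyc_partition_expg.
- exact: cyc_partition_expg.
exact: mem_zexp.
Qed.

End Block.

(** * Classification of the unital partitions *)

(** By the multiplier theorem, lying in the same block is a shift-invariant equivalence [R] on
    logarithms. It is therefore congruence modulo the least positive [u] equivalent to 0. *)
Lemma unital_cyc_partition (P : {set {set gT}}) : unital_partition <[x]> P ->
  exists2 u, u %| p.-1 & P = cyc_partition p x alpha u.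
Proof.
move=> unP; have [partP P1 _] := unP.
have [covP tiP] := (cover_partition partP, partition_trivIset partP).
pose R i j := pblock P (zexp i) == pblock P (zexp j).
have shiftR k i j : R (i + k) (j + k) = R i j.
  by rewrite /R !zexpD (eq_pblock_expg (cycle_abelian x) unP) ?coprime_zeta ?mem_zexp.
have zexp_period : zexp p.-1 = zexp 0 by apply/eqP; rewrite eq_zexp modnn mod0n.
have exu : exists u, (0 < u) && R 0 u.
  by exists p.-1; rewrite p1_gt0 /R zexp_period /=.
case: (ex_minnP exu) => u /andP[u_gt0 R0u] min_u {exu}.
have Rmul k m : R k (m * u + k).
  elim: m => [|m IHm]; first by rewrite /R mul0n.
  have := shiftR (m * u + k) 0 u; rewrite R0u add0n addnA -mulSn => /eqP eqm.
  by rewrite /R -eqm.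
have R0 k : R 0 k = (u %| k).
  apply/idP/idP => [R0k | /dvdnP[m ->]]; last by have := Rmul 0 m; rewrite addn0.
  (* The remainder is also equivalent to 0, so minimality of [u] forces it to vanish. *)
  have R0m : R 0 (k %% u).
    apply/eqP; have /eqP -> := Rmul (k %% u) (k %/ u).
    by rewrite -divn_eq; apply/eqP.
  rewrite /dvdn -leqn0 leqNgt; apply/negP => gt0.
  by have := min_u (k %% u); rewrite gt0 R0m leqNgt ltn_pmod // => /(_ isT).
have RE i j : R i j = (i == j %[mod u]).
  wlog le_ij : i j / i <= j.
    move=> IH; have [/IH // | /ltnW/IH] := leqP i j.
    by rewrite [RHS]eq_sym /R eq_sym.
  by rewrite eq_sym eqn_mod_dvd // -R0 -(shiftR i 0) add0n subnK.
have dv_u : u %| p.-1.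
  by rewrite -R0 /R zexp_period.
have pblockE (i k : nat) : k = i %[mod u] -> pblock P (zexp k) = cyc_block p x alpha u i.
  move=> eqki; apply/setP=> y; apply/idP/(cyc_blockP dv_u) => [ | [l -> eqli]].
    move=> Py; have Gy : y \in <[x]>.
      by apply: subsetP (partitionS partP _) _ Py; rewrite pblock_mem ?covP ?mem_zexp.
    move: Py; rewrite (in_pblockE partP) ?mem_zexp //.
    have [-> | [l -> ]] := cycleP_zexp Gy.
      (* The identity is excluded because its block is a singleton, while [zexp k] differs from
         1. *)
      rewrite (def_pblock tiP P1 (set11 1)) => /eqP P1E.
      have : zexp k \in pblock P (zexp k) by rewrite mem_pblock covP mem_zexp.
      by rewrite -P1E inE (negPf (zexp_neq1 k)).
    by rewrite -/(R l k) RE => /eqP eqlk; exists l; rewrite ?eqlk.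
  by rewrite (in_pblockE partP) ?mem_zexp // -/(R l k) RE eqli eqki.
exists u => //; apply/setP=> B; rewrite !inE; apply/idP/orP.
  move=> PB; have [y [Gy By ->]] := partition_repr partP PB.
  have [-> | [k ->]] := cycleP_zexp Gy.
    by left; rewrite (def_pblock tiP P1 (set11 1)).
  right; apply/imsetP; exists (Ordinal (ltn_pmod k u_gt0)) => //.
  by apply: pblockE; rewrite /= modn_mod.
case=> [/eqP-> // | /imsetP[i _ ->]].
by rewrite -(pblockE i i) // pblock_mem ?covP ?mem_zexp.
Qed.

End PrimeOrder.

Theorem theorem3p10 (p : nat) (gT : finGroupType) (G : {group gT}) (x : gT)
    (alpha : int) :
  prime p -> odd p -> #|G| = p -> G = <[x]>%G :> {set gT} ->
  primitive_root_of_unity p.-1 (alpha%:~R : 'F_p)%R ->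
  [/\ (forall u : nat, (u %| p.-1)%N -> unital_partition G (cyc_partition p x alpha u)),
      (forall P : {set {set gT}}, unital_partition G P ->
         exists2 u : nat, (u %| p.-1)%N & P = cyc_partition p x alpha u) &
      (forall P : {set {set gT}}, unital_partition G P -> fusion_partition G P)].
Proof.
move=> p_pr _ oG defG prim_alpha.
have {}defG : G = <[x]>%G by apply: val_inj.
have ox : #[x] = p by rewrite orderE -oG defG.
rewrite {}defG; split=> [u dv_u | P unP | P unP].
- exact: cyc_partition_unital.
- exact: unital_cyc_partition.
exact: unital_fusion (cycle_abelian x) unP.
Qed.
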